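(* Let $n\ge 2$ be an integer and let $Q_{4n}=\langle x,y : x^{2n}=1,\ x^n=y^2,\ yx=x^{-1}y\rangle$ be the generalized quaternion group of order $4n$. Let $\Gamma_{Q_{4n}}$ be its non-commuting graph. Then the spectrum of the distance Laplacian matrix $D^L(\Gamma_{Q_{4n}})$ (eigenvalues counted with multiplicity, multiplicities being added if two of the listed values coincide) consists of: (a) $0$ with multiplicity $1$; (b) $4n-2$ and $4n$, each with multiplicity $n$; (c) $6n-4$ with multiplicity $2n-3$.
   Context: For a finite non-abelian group $G$ with centre $Z(G)$, the non-commuting graph $\Gamma_G$ is the simple undirected graph with vertex set $G\setminus Z(G)$, in which two distinct vertices $u,v$ are adjacent if and only if $uv\ne vu$. For a connected graph $H$, $d_{uv}$ denotes the length of a shortest path between $u$ and $v$; the distance matrix $D(H)$ has $(u,v)$-entry $d_{uv}$. The transmission of a vertex $v$ is $\sum_{u} d_{uv}$, and $Tr(H)$ is the diagonal matrix of vertex transmissions. The distance Laplacian matrix is $D^L(H)=Tr(H)-D(H)$. *)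

(* Defs.v *)
From HB Require Import structures.
From mathcomp Require Import all_boot all_order all_algebra all_fingroup all_solvable all_field.
Set Implicit Arguments. Unset Strict Implicit. Unset Printing Implicit Defensive.
Import GRing.Theory Num.Theory.

Local Open Scope group_scope.

Section NonCommuting.
Variables (gT : finGroupType) (G : {group gT}).

Definition nc_vertices : {set gT} := G :\: 'Z(G).

(* adjacency: distinct vertices u, v with uv <> vu (uv <> vu forces u <> v) *)
Definition nc_adj : rel gT :=
  fun u v => [&& u \in nc_vertices, v \in nc_vertices & u * v != v * u].

Definition nc_walk (k : nat) (u v : gT) : bool :=
  [exists p : k.-tuple gT, path nc_adj u p && (last u p == v)].

(* graph distance: the least length of a walk (= shortest path) from u to v;
   (only meaningful on a connected graph, which is the case here) *)
Definition nc_dist (u v : gT) : nat :=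
  find (fun k => nc_walk k u v) (iota 0 #|gT|).

Definition nc_vtx (i : 'I_#|nc_vertices|) : gT := enum_val i.

Definition nc_distmx : 'M[algC]_#|nc_vertices| :=
  \matrix_(i, j) (nc_dist (nc_vtx i) (nc_vtx j))%:R%R.

Definition nc_trmx : 'M[algC]_#|nc_vertices| :=
  diag_mx (\row_i \sum_j nc_distmx i j)%R.

Definition nc_distLap : 'M[algC]_#|nc_vertices| := (nc_trmx - nc_distmx)%R.

End NonCommuting.

(* Main.v *)
Require Import Defs.
From HB Require Import structures.
From mathcomp Require Import all_boot all_order all_algebra all_fingroup all_solvable all_field.
Import GRing.Theory Num.Theory.

(** Commuting is an equivalence relation on G \ Z(G): the noncentral powers of x
    form one class and every other element v has class v Z(G) of size 2.  Hence
    the graph is complete multipartite and D^L = diag(N + p_v) - J - B, where N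
    is the number of vertices, p_v the size of the part of v, J the all-ones
    matrix and B the indicator of lying in the same part.  With U the
    vertex/part incidence matrix, J + B = U V, and the diagonal matrix
    intertwines with U, so the determinant of t - D^L reduces to one indexed by
    the parts; there the matrix is a scalar plus a rank-one matrix. *)

(** * Determinant of a low-rank update, and the characteristic polynomial attached to a partition *)

Section Multipartite.
Local Open Scope ring_scope.

(** The block matrix [B] is triangularized in two ways: row elimination isolates [D + U *m V], while
    right multiplication by a block matrix containing [E] clears the upper right corner because
    [D *m U = U *m E]. No inverse is taken, so polynomial entries are allowed. *)
Lemma det_update (R : comNzRingType) (p q : nat) (D : 'M[R]_p) (E : 'M[R]_q)
    (U : 'M[R]_(p, q)) (V : 'M[R]_(q, p)) :
  D *m U = U *m E ->
  \det (D + U *m V) * \det E = \det D * \det (E + V *m U).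
Proof.
move=> DU; pose B := block_mx D (- U) V 1%:M.
have <- : \det B = \det (D + U *m V).
  have : block_mx 1%:M U 0 1%:M *m B = block_mx (D + U *m V) 0 V 1%:M.
    by rewrite mulmx_block !mul1mx !mul0mx mulmx1 !add0r addNr.
  by move/(congr1 determinant); rewrite det_mulmx det_ublock det_lblock !det1 !mulr1 mul1r.
have : B *m block_mx 1%:M U 0 E = block_mx D 0 V (E + V *m U).
  by rewrite mulmx_block !mulmx1 !mulmx0 !mul1mx !addr0 mulNmx DU addrN [V *m U + E]addrC.
by move/(congr1 determinant); rewrite det_mulmx det_ublock det_lblock det1 mul1r.
Qed.

(** This is [det_update] with a single column and [E] the scalar [s]; the surplus factor [s] is
    cancelled. *)
Lemma det_scalar_update (R : idomainType) (m : nat) (s : R) (p : 'rV[R]_m) :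
  s != 0 -> (0 < m)%N ->
  \det (s%:M + const_mx 1 *m p) = s ^+ m.-1 * (s + \sum_k p 0 k).
Proof.
move=> s0 m0; apply: (mulIf s0).
have := @det_update R m 1 s%:M s%:M (const_mx 1) p.
rewrite scalar_mxC => /(_ erefl); rewrite !det_scalar expr1 => ->.
rewrite det_mx11 !mxE eqxx mulr1n -{1}(prednK m0) exprSr.
under eq_bigr => k _ do rewrite mxE mulr1.
by rewrite mulrAC.
Qed.

(** When [c] takes at least two values, [M] is the distance Laplacian of the complete multipartite
    graph with part map [c]: distances are 1 across parts and 2 inside a part, so the transmission
    of [i] is [N + p (c i) - 2]. As [S] is the image of [c], every part is nonempty and the
    predecessors in the exponents do not truncate. *)
Lemma char_poly_multipartite (F : idomainType) (N : nat) (K : finType) (c : 'I_N -> K) :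
  let S := [set c i | i in 'I_N] in
  let p k := #|[set i | c i == k]| in
  let M := \matrix_(i, j) ((N + p (c i))%:R *+ (i == j) - 1 - (c i == c j)%:R) in
  (0 < N)%N ->
  char_poly (M : 'M[F]_N) =
    'X * ('X - N%:R%:P) ^+ #|S|.-1 *
      \prod_(k in S) ('X - (N + p k)%:R%:P) ^+ (p k).-1.
Proof.
move=> S p M N0.
pose e k : {poly F} := 'X - (N + p k)%:R%:P.
have cS i : c i \in S by apply: imset_f.
have p0 k : k \in S -> (0 < p k)%N.
  by case/imsetP=> i _ ->; apply/card_gt0P; exists i; rewrite inE.
have S0 : (0 < #|S|)%N by apply/card_gt0P; exists (c (Ordinal N0)).
have e0 : \prod_(k in S) e k != 0.
  by apply/prodf_neq0 => k _; rewrite polyXsubC_eq0.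
pose v (k : 'I_#|S|) := enum_val k.
pose U : 'M[{poly F}]_(N, #|S|) := \matrix_(i, k) (c i == v k)%:R.
(* The summand 1 produces the all-ones matrix in [U *m V], the indicator produces the same-part
   matrix. *)
pose V : 'M[{poly F}]_(#|S|, N) := \matrix_(k, j) (1 + (c j == v k)%:R).
pose D : 'M[{poly F}]_N := diag_mx (\row_i e (c i)).
pose E : 'M[{poly F}]_#|S| := diag_mx (\row_k e (v k)).
have DU : D *m U = U *m E.
  apply/matrixP=> i k; rewrite mul_diag_mx mul_mx_diag !mxE.
  by case: eqP => [->|_]; rewrite ?mulr1 ?mul1r ?mulr0 ?mul0r.
have sumv (G : K -> {poly F}) i : \sum_k (c i == v k)%:R * G (v k) = G (c i).
  rewrite -(big_enum_val (A := mem S) (fun a => (c i == a)%:R * G a)) /=.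
  rewrite (bigD1 (c i)) ?cS //= eqxx mul1r big1 ?addr0 // => k /andP[_].
  by rewrite eq_sym => /negPf ->; rewrite mul0r.
have MUV : char_poly_mx M = D + U *m V.
  apply/matrixP=> i j; rewrite !mxE.
  under eq_bigr => k _ do rewrite !mxE.
  rewrite (sumv (fun k => 1 + (c j == k)%:R)) [c j == _]eq_sym.
  rewrite !rmorphB rmorphMn !rmorph1 /= rmorph_nat.
  by case: (i == j); rewrite ?mulr1n ?mulr0n /e !opprD !opprK ?addrA ?rmorph_nat // oppr0 add0r.
have sump k : \sum_j (c j == k)%:R = (p k)%:R :> {poly F}.
  rewrite /p -sum1_card natr_sum [RHS]big_mkcond; apply: eq_bigr => j _.
  by rewrite inE; case: eqP.
(* Entry [(k, l)] of [V *m U] is [p (v l)] plus [p (v k)] on the diagonal; the latter cancels the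
   part size in [E], leaving a scalar matrix plus a rank-one matrix. *)
have EVU : E + V *m U = ('X - N%:R%:P)%:M + const_mx 1 *m (\row_k (p (v k))%:R).
  apply/matrixP=> k l; rewrite !mxE big_ord1 !mxE mul1r.
  under eq_bigr => j _ do rewrite !mxE mulrDl mul1r.
  rewrite big_split /= sump.
  have -> : \sum_j (c j == v k)%:R * (c j == v l)%:R = (p (v k))%:R *+ (k == l) :> {poly F}.
    rewrite -sump -sumrMnl; apply: eq_bigr => j _.
    case: (c j =P v k) => [->|_]; last by rewrite mul0r mul0rn.
    by rewrite mul1r (inj_eq enum_val_inj).
  rewrite [_%:R + _]addrC addrA -mulrnDl /e natrD polyCD opprD addrA.
  by rewrite !polyC_natr subrK.
have detE : \det E = \prod_(k in S) e k.
  rewrite det_diag (big_enum_val (A := mem S)).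
  by apply: eq_bigr => i _; rewrite mxE.
have detD : \det D = \prod_(k in S) e k ^+ p k.
  rewrite det_diag (partition_big c (mem S)) //=; apply: eq_bigr => k kS.
  rewrite -prodr_const; apply: eq_big => [i|i /eqP <-]; first by rewrite inE.
  by rewrite mxE.
(* [\det D] contains [e k] to the power [p k] and [\det E] contains it once; cancelling [\det E]
   lowers each exponent by one. *)
apply: (mulIf e0); rewrite -detE [char_poly M]/(\det _) MUV det_update // EVU.
rewrite det_scalar_update ?polyXsubC_eq0 // detD detE.
(* The part sizes add up to [N], which gives the eigenvalue 0. *)
have -> : 'X - N%:R%:P + \sum_k (\row_k (p (v k))%:R) 0 k = 'X :> {poly F}.
  under eq_bigr => k _ do rewrite mxE.
  rewrite -natr_sum -(big_enum_val (A := mem S) p) /=.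
  rewrite -[X in _ + X%:R](_ : N = _) ?polyC_natr ?subrK //.
  rewrite -[LHS]card_ord -sum1_card (partition_big c (mem S)) //=; apply: eq_bigr => k _.
  by rewrite /p -sum1_card; apply: eq_bigl => i; rewrite inE.
rewrite -!mulrA mulrC -mulrA [in RHS]mulrCA -big_split /=.
congr (_ * (_ * _)); apply: eq_bigr => k kS.
by rewrite -exprSr prednK ?p0.
Qed.
End Multipartite.

(** * Non-commuting graphs in which commuting is an equivalence relation with classes given by
    [f] *)

Section NonCommutingGraph.
Local Open Scope group_scope.
Variables (gT : finGroupType) (G : {group gT}).
Local Notation V := (nc_vertices G).

Lemma nc_walk0 (u v : gT) : nc_walk G 0 u v = (u == v).
Proof.
apply/existsP/eqP => [[p]|->]; first by rewrite tuple0 => /eqP.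
by exists [tuple]; rewrite /= eqxx.
Qed.

Lemma nc_walkS (k : nat) (u v : gT) :
  nc_walk G k.+1 u v = [exists w, nc_adj G u w && nc_walk G k w v].
Proof.
apply/existsP/existsP => [[p]|[w /andP[uw /existsP[p pv]]]].
  case/tupleP: p => w p /= /andP[/andP[uw pw] pv].
  by exists w; rewrite uw; apply/existsP; exists p; rewrite pw.
by exists [tuple of w :: p]; rewrite /= uw.
Qed.

Context {K : finType}.
Variable f : gT -> K.
Hypothesis fP : {in V &, forall u v, (u * v == v * u) = (f u == f v)}.
Hypothesis f_nonconstant : {in V, forall u, exists2 w, w \in V & f w != f u}.

(** Distinct vertices of one class are not adjacent, but any vertex of another class is a common
    neighbour, so their distance is 2. *)
Lemma nc_dist_multipartite : {in V &, forall u v,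
  nc_dist G u v = if u == v then 0%N else (f u == f v).+1}.
Proof.
move=> u v uV vV.
have adjE a b : a \in V -> b \in V -> nc_adj G a b = (f a != f b).
  by move=> aV bV; rewrite /nc_adj aV bV fP.
have walk1 a b : nc_walk G 1 a b = nc_adj G a b.
  rewrite nc_walkS; apply/existsP/idP => [[w]|ab].
    by rewrite nc_walk0 => /andP[aw /eqP <-].
  by exists b; rewrite ab nc_walk0 /=.
rewrite /nc_dist; case: eqVneq => [<-|uv].
  case: #|gT| (cardD1 (1 : gT) gT) => [//|m _] /=.
  by rewrite nc_walk0 eqxx.
(* [nc_dist] only searches lengths below [#|gT|], so length 2 must be in range; 1, [u] and [v] are
   three distinct elements, since 1 is central. *)
have : (2 < #|gT|)%N.
  have V1 : 1 \notin V by rewrite inE group1.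
  have <- : #|[set 1; u; v]| = 3.
    rewrite -setUA cardsU1 cards2 uv !inE negb_or.
    by rewrite !(contraNneq _ V1) // => ->.
  exact: max_card.
case: #|gT| => [|[|[|m]]] //= _; rewrite nc_walk0 (negPf uv) walk1 adjE //.
case: eqP => //= fuv; rewrite nc_walkS; case: existsP => //= -[].
have [w wV fwu] := f_nonconstant _ uV.
by exists w; rewrite walk1 !adjE // -fuv fwu eq_sym fwu.
Qed.

Lemma char_poly_nc_distLap : (0 < #|V|)%N ->
  let p k := #|[set u in V | f u == k]| in
  (char_poly (nc_distLap G) =
    'X * ('X - #|V|%:R%:P) ^+ #|f @: V|.-1 *
      \prod_(k in f @: V) ('X - (#|V| + p k)%:R%:P) ^+ (p k).-1)%R.
Proof.
move=> V0 p; pose c (i : 'I_#|V|) := f (nc_vtx i).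
have vV (i : 'I_#|V|) : nc_vtx i \in V by apply: (enum_valP i).
have pE k : #|[set i | c i == k]| = p k.
  rewrite -(card_imset _ enum_val_inj); apply: eq_card => u.
  apply/imsetP/idP => [[i]|].
    by move=> ci ->; rewrite inE in ci; rewrite inE; apply/andP; split; [exact: vV|].
  rewrite in_set => /andP[uV fu]; exists (enum_rank_in uV u); last by rewrite enum_rankK_in.
  by rewrite in_set /c /nc_vtx enum_rankK_in.
have SE : [set c i | i in 'I_#|V|] = f @: V.
  apply/setP=> k; apply/imsetP/imsetP => [[i _ ->]|[u uV ->]].
    by exists (nc_vtx i).
  by exists (enum_rank_in uV u); rewrite // /c /nc_vtx enum_rankK_in.
have := char_poly_multipartite algC _ _ c V0; rewrite /= SE.
under eq_bigr => k _ do rewrite pE.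
move=> <-; congr char_poly; rewrite /nc_distLap /nc_trmx.
(* The term [2%:R *+ (i == j)] corrects the diagonal, where the first two terms give 2 instead of 0.
   The same correction lowers each transmission by 2, and the two cancel in the Laplacian. *)
have -> : nc_distmx G = (\matrix_(i, j) (1 + (c i == c j)%:R - 2%:R *+ (i == j)))%R.
  apply/matrixP=> i j; rewrite !mxE nc_dist_multipartite //.
  rewrite /nc_vtx (inj_eq enum_val_inj) -/(nc_vtx i) -/(nc_vtx j).
  case: eqP => [->|_]; rewrite ?eqxx ?mulr1n ?mulr0n; first by rewrite subrr.
  by rewrite subr0 -addn1 natrD addrC.
apply/matrixP=> i j; rewrite !mxE.
under eq_bigr => k _ do rewrite mxE.
have -> : (\sum_k (1 + (c i == c k)%:R - 2%:R *+ (i == k)) = (#|V| + p (c i))%:R - 2%:R :> algC)%R.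
  rewrite !big_split /= sumr_const card_ord natrD sumrN; congr (_ + _ - _)%R.
    rewrite -pE -sum1_card natr_sum [RHS]big_mkcond; apply: eq_bigr => k _.
    by rewrite inE eq_sym; case: eqP.
  rewrite (bigD1 i) //= eqxx big1 ?addr0 // => k.
  by rewrite eq_sym => /negPf ->.
rewrite pE; case: (i == j); rewrite ?mulr1n ?mulr0n ?subr0 ?sub0r ?opprD //.
rewrite -[(- (-1) - -1)%R]opprD [X in (_ + X = _)%R]addrC.
by rewrite [LHS]addrA addrK addrA.
Qed.

End NonCommutingGraph.

(** * Structure of the generalized quaternion group: the cyclic subgroup, the centre and the
    commuting classes *)

Section Quaternion.
Local Open Scope group_scope.
Variables (n : nat) (gT : finGroupType) (G : {group gT}) (x y : gT).
Hypotheses (n2 : (2 <= n)%N) (Gxy : G = <<[set x; y]>>%G :> {set gT})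
  (x2n : x ^+ (2 * n) = 1) (xny2 : x ^+ n = y ^+ 2) (yx : y * x = x^-1 * y)
  (cardG : #|G| = (4 * n)%N).
Local Notation H := <[x]>.
Local Notation Z := 'Z(G).
Local Notation V := (nc_vertices G).

Lemma conj_y_inv (a : gT) : a \in H -> a ^ y = a^-1.
Proof.
have xy : x ^ y = x^-1.
  by apply: invg_inj; rewrite -conjVg invgK conjgE -yx mulKg.
by case/cycleP=> i ->; rewrite conjXg xy expgVn.
Qed.

Lemma x_in_G : x \in G. Proof. by rewrite Gxy mem_gen // !inE eqxx. Qed.
Lemma y_in_G : y \in G. Proof. by rewrite Gxy mem_gen // !inE eqxx orbT. Qed.
Lemma H_sub_G : H \subset G. Proof. by rewrite cycle_subG x_in_G. Qed.

(** [y] normalizes [H] and its square [x ^+ n] lies in [H], so only the parity of the exponent of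
    [y] matters. *)
Lemma quaternion_cosets : G = H :|: H :* y :> {set gT}.
Proof.
have yN : y \in 'N(H).
  by apply/normP/eqP; rewrite eqEcard cardJg leqnn andbT -cycleJ conj_y_inv ?cycle_id // cycleV.
apply/eqP; rewrite eqEsubset subUset H_sub_G mul_subG ?sub1set ?H_sub_G ?y_in_G //.
have GHy : G = H * <[y]> :> {set gT}.
  by rewrite -norm_joinEr ?cycle_subG // Gxy joing_idl joing_idr.
rewrite !andbT GHy; apply/subsetP=> _ /mulsgP[a _ aH /cycleP[j ->] ->].
have yj : y ^+ j = (x ^+ n) ^+ j./2 * y ^+ odd j.
  by rewrite xny2 -expgM mul2n -expgD addnC odd_double_half.
rewrite yj mulgA inE; set b := a * _.
have bH : b \in H by rewrite groupM // !groupX ?cycle_id.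
case: (odd j); last by rewrite expg0 mulg1 bH.
by rewrite expg1 orbC mem_rcoset mulgK bH.
Qed.

(** The relation bounds the order above by [2 * n]; covering [G] by two cosets of [H] bounds it
    below. *)
Lemma order_x : #[x] = (2 * n)%N.
Proof.
apply/eqP; rewrite eqn_leq dvdn_leq ?order_dvdn ?x2n ?muln_gt0 ?(ltnW n2) //=.
have : #|G| <= #|H| + #|H :* y| by rewrite quaternion_cosets cardsU leq_subr.
rewrite card_rcoset addnn -mul2n cardG -[#|H|]/#[x].
by rewrite -[4]/(2 * 2)%N -mulnA leq_pmul2l.
Qed.

Lemma notin_H_eq_mul_y (v : gT) : v \in G -> v \notin H -> exists2 a, a \in H & v = a * y.
Proof.
rewrite quaternion_cosets inE => /orP[->//|]; rewrite mem_rcoset => vy _.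
by exists (v * y^-1); rewrite ?mulgKV.
Qed.

Lemma y_notinH : y \notin H.
Proof.
apply/negP => yH; have : #|G| <= #|H|.
  by rewrite quaternion_cosets rcoset_id // setUid.
by rewrite cardG -[#|H|]/#[x] order_x leq_pmul2r // (ltnW n2).
Qed.

(** Write [v] as [b * y] with [b] in [H]: [b] commutes with [a], and [y] inverts it. *)
Lemma conj_notin_H (a v : gT) : a \in H -> v \in G -> v \notin H -> a ^ v = a^-1.
Proof.
move=> aH vG vH; have [b bH ->] := notin_H_eq_mul_y v vG vH.
rewrite conjgM conj_y_inv ?memJ_norm ?(subsetP (normG _)) //.
by rewrite (conjg_fixP _) //; apply/commgP/(centsP (cycle_abelian x)).
Qed.

Lemma mulVg_in_H (u v : gT) : u \in G -> v \in G -> u \notin H -> v \notin H -> u^-1 * v \in H.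
Proof.
move=> uG vG uH vH; have [a aH ->] := notin_H_eq_mul_y u uG uH; have [b bH ->] := notin_H_eq_mul_y v vG vH.
have -> : (a * y)^-1 * (b * y) = (a^-1 * b) ^ y by rewrite conjgE invMg !mulgA.
by rewrite conj_y_inv ?groupV groupM ?groupV.
Qed.

Lemma x_neq_inv : x^-1 != x.
Proof.
apply/negP=> /eqP xV; have : #[x] %| 2 by rewrite order_dvdn expgS expg1 -{1}xV mulVg.
rewrite order_x => /dvdn_leq => /(_ isT).
by rewrite leqNgt (leq_trans _ (leq_mul (leqnn 2) n2)).
Qed.

(** A central element outside [H] would both fix and invert [x], whose order exceeds 2. *)
Lemma Z_sub_H : Z \subset H.
Proof.
apply/subsetP=> z /centerP[zG zC]; apply: contraR x_neq_inv => zH.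
by rewrite -(conj_notin_H _ _ (cycle_id x) zG zH) conjgE -zC ?x_in_G // mulKg.
Qed.

(** Commuting with one element outside [H] forces [a] to be its own inverse; then every element
    outside [H] fixes it, and [H] is abelian. *)
Lemma mem_Z (a v : gT) : a \in H -> v \in G -> v \notin H -> (a \in Z) = (a * v == v * a).
Proof.
move=> aH vG vH; apply/idP/eqP => [/centerP[_ ->]//|av].
have aV : a^-1 = a by rewrite -(conj_notin_H _ _ aH vG vH) conjgE av mulKg.
apply/centerP; split=> [|w wG]; first exact: (subsetP H_sub_G).
case: (boolP (w \in H)) => wH; first exact: (centsP (cycle_abelian x)).
by apply/commgP/conjg_fixP; rewrite conj_notin_H.
Qed.

Lemma card_Z : #|Z| = 2.
Proof.
have nx : x ^+ n != 1.
  rewrite -order_dvdn order_x; apply/negP=> /dvdn_leq; rewrite (ltnW n2) => /(_ isT).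
  by rewrite leqNgt mul2n -addnn -{1}[n]addn0 ltn_add2l (ltnW n2).
suff -> : Z = [set 1; x ^+ n] by rewrite cards2 eq_sym nx.
apply/setP=> z; rewrite in_set2; apply/idP/orP => [zZ|[]/eqP->].
- have zH := subsetP Z_sub_H z zZ; case/cycleP: (zH) => i zi.
  have zV : z^-1 = z.
    by rewrite -(conj_y_inv _ zH); apply/conjg_fixP/commgP; case/centerP: zZ => _; apply; apply: y_in_G.
  (* A central [x ^+ i] is self-inverse, so [2 * n] divides [2 * i]; the parity of [i / n] then
     decides between 1 and [x ^+ n]. *)
  have /dvdnP[k ik] : n %| i.
    rewrite -(@dvdn_pmul2l 2) // -order_x order_dvdn mulnC expgM -zi.
    by rewrite expgS expg1 -{1}zV mulVg.
  rewrite zi ik mulnC expgM -[k]odd_double_half expgD -mul2n.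
  rewrite [_ ^+ (2 * _)]expgM -[_ ^+ n ^+ 2]expgM [(n * 2)%N]mulnC x2n expg1n mulg1.
  by case: (odd k); rewrite ?expg1 ?expg0 eqxx; [right|left].
- exact: group1.
- rewrite (mem_Z _ y) ?y_in_G ?y_notinH ?groupX ?cycle_id // xny2.
  by rewrite -expgSr expgS.
Qed.

(** Labels for the commuting classes. [H] stands for the class of noncentral powers of [x], the
    central ones being dropped on intersecting with [V]; outside [H] the label is the class
    itself. *)
Definition nc_part (v : gT) : {set gT} := if v \in H then H else v *: Z.

Lemma mem_V (v : gT) : v \in G -> v \notin H -> v \in V.
Proof. by move=> vG vH; rewrite inE vG andbT (contra (subsetP Z_sub_H v)). Qed.

Lemma lcoset_Z_neq_H (v : gT) : v \notin H -> (v *: Z == H) = false.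
Proof. by move=> vH; apply: contraNF vH => /eqP <-; apply: lcoset_refl. Qed.

Lemma nc_partP : {in V &, forall u v, (u * v == v * u) = (nc_part u == nc_part v)}.
Proof.
move=> u v /setDP[uG uZ] /setDP[vG vZ]; rewrite /nc_part.
case: (boolP (u \in H)) => uH; case: (boolP (v \in H)) => vH.
- by rewrite eqxx; apply/eqP/(centsP (cycle_abelian x)).
- by rewrite -mem_Z // eq_sym lcoset_Z_neq_H // (negPf uZ).
- by rewrite eq_sym -mem_Z // lcoset_Z_neq_H // (negPf vZ).
(* With both elements outside [H], [v = u * a] for some [a] in [H]; [u] commutes with [u * a] iff it
   commutes with [a], that is, iff [a] is central. *)
have -> : v = u * (u^-1 * v) by rewrite mulKVg.
set a := u^-1 * v; have aH : a \in H by apply: mulVg_in_H.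
rewrite -[X in _ == X]mulgA (inj_eq (mulgI u)) eq_sym -mem_Z //.
rewrite eq_sym lcosetM (inj_eq (@lcoset_inj _ u)) -{2}[Z : {set gT}]lcoset1.
by apply/idP/eqP => [/lcoset_id | <-]; rewrite ?lcoset1 ?lcoset_refl.
Qed.

Lemma nc_part_nonconstant :
  {in V, forall u, exists2 w, w \in V & nc_part w != nc_part u}.
Proof.
move=> u _; rewrite /nc_part.
case: (boolP (u \in H)) => uH.
  by exists y; rewrite ?mem_V ?y_in_G ?y_notinH // (negPf y_notinH) lcoset_Z_neq_H ?y_notinH.
exists x; last by rewrite cycle_id eq_sym lcoset_Z_neq_H.
rewrite inE x_in_G andbT; apply: contra x_neq_inv => xZ.
rewrite -(conj_y_inv _ (cycle_id x)); apply/eqP/conjg_fixP/commgP.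
by case/centerP: xZ => _; apply; apply: y_in_G.
Qed.

Lemma card_V : #|V| = (4 * n - 2)%N.
Proof. by rewrite cardsD (setIidPr (center_sub G)) card_Z cardG. Qed.

Lemma card_nc_part_H : #|[set u in V | nc_part u == H]| = (2 * n - 2)%N.
Proof.
have -> : [set u in V | nc_part u == H] = H :\: Z.
  apply/setP=> u; rewrite !inE -!/(u \in Z) /nc_part.
  case: ifP => [uH|/negbT uH]; last by rewrite lcoset_Z_neq_H ?(negPf uH) ?andbF.
  by rewrite eqxx andbT (subsetP H_sub_G).
by rewrite cardsD (setIidPr Z_sub_H) card_Z -[#|H|]/#[x] order_x.
Qed.

Lemma card_nc_part_lcoset (v : gT) : v \in G -> v \notin H ->
  #|[set u in V | nc_part u == v *: Z]| = 2.
Proof.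
move=> vG vH; rewrite -card_Z -(card_lcoset Z v); apply: eq_card => u.
rewrite in_set /nc_part.
case: (boolP (u \in H)) => uH.
  rewrite eq_sym lcoset_Z_neq_H // andbF mem_lcoset; apply/esym/negbTE.
  apply: contra vH => /(subsetP Z_sub_H) vuH.
  by rewrite -groupV -(groupMr _ uH).
apply/andP/idP => [[_ /eqP <-]|uvZ]; first exact: lcoset_refl.
have uG : u \in G.
  move: uvZ; rewrite mem_lcoset => /(subsetP (center_sub G)).
  by rewrite groupMl ?groupV.
by rewrite mem_V // (lcoset_eqP uvZ).
Qed.

(** There are [n + 1] parts: one of size [2 * n - 2], giving [6 * n - 4], and [n] of size 2, each
    giving [4 * n] once. The eigenvalue [4 * n - 2] has multiplicity one less than the number of
    parts. *)
Lemma char_poly_quaternion :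
  char_poly (nc_distLap G) =
    ('X * ('X - ((4 * n - 2)%N)%:R%:P) ^+ n * ('X - ((4 * n)%N)%:R%:P) ^+ n
        * ('X - ((6 * n - 4)%N)%:R%:P) ^+ (2 * n - 3))%R.
Proof.
pose T := nc_part @: (G :\: H).
have TP k : k \in T -> exists v, [/\ v \in G, v \notin H & k = v *: Z].
  by case/imsetP=> v /setDP[vG vH] ->; exists v; rewrite /nc_part (negPf vH).
have HT : H \notin T.
  by apply/negP=> /TP[v [_ vH /esym/eqP]]; rewrite lcoset_Z_neq_H.
have partV : nc_part @: V = H |: T.
  apply/setP=> k; rewrite in_setU1.
  apply/imsetP/orP => [[v /setDP[vG vZ] ->]|[/eqP->|/TP[v [vG vH ->]]]].
  - rewrite {1}/nc_part; case: (boolP (v \in H)) => vH; [by left | right].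
    by apply: imset_f; rewrite inE vH.
  - have /set0Pn[v] : [set u in V | nc_part u == H] != set0.
      by rewrite -card_gt0 card_nc_part_H subn_gt0 -[2]muln1 ltn_mul2l n2.
    by rewrite in_set => /andP[vV /eqP <-]; exists v.
  - by exists v; rewrite ?mem_V // /nc_part (negPf vH).
(* The [2 * n] elements outside [H] split into cosets of the centre of size 2. *)
have cardT : #|T| = n.
  have : #|G :\: H| = (2 * n)%N.
    rewrite cardsD (setIidPr H_sub_G) cardG -[#|H|]/#[x] order_x -mulnBl //.
  rewrite -sum1_card (partition_big_imset nc_part) /= -/T.
  rewrite (eq_bigr (fun=> 2)) => [|k /TP[v [vG vH ->]]].
    by rewrite sum_nat_const mulnC => /eqP; rewrite eqn_pmul2l // => /eqP.
  rewrite sum1_card -(card_nc_part_lcoset _ vG vH); apply: eq_card => u.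
  rewrite in_set unfold_in /= in_setD.
  case: (boolP (u \in H)) => uH /=; first by rewrite /nc_part uH eq_sym lcoset_Z_neq_H ?andbF.
  case: (boolP (u \in G)) => uG /=; first by rewrite mem_V.
  by apply/esym; apply: contraNF uG => /andP[/setDP[]].
rewrite (char_poly_nc_distLap _ _ nc_part nc_partP nc_part_nonconstant); last first.
  by rewrite card_V subn_gt0 (leq_trans _ (leq_mul (leqnn 4) n2)).
rewrite partV cardsU1 HT cardT big_setU1 //= card_nc_part_H card_V.
rewrite (eq_bigr (fun=> ('X - (4 * n)%:R%:P)%R)) => [|k /TP[v [vG vH ->]]]; last first.
  by rewrite card_nc_part_lcoset // subnK // (leq_trans (_ : 2 <= 4 * 1)) ?leq_pmul2l // ltnW.
rewrite prodr_const cardT [in RHS]mulrAC -!mulrA.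
have -> : (4 * n - 2 + (2 * n - 2) = 6 * n - 4)%N.
  by rewrite addnBA ?addnBAC -?subnDA -?mulnDl // (leq_trans n2) ?leq_pmull.
by rewrite -subn1 -subnDA.
Qed.

End Quaternion.

(* G = <x, y> is the generalized quaternion group Q_{4n}: generated by x, y
   satisfying the defining relations and of order 4n.  The spectrum of the
   distance Laplacian is given via its characteristic polynomial. *)
Theorem theorem3p2 (n : nat) (gT : finGroupType) (G : {group gT}) (x y : gT) :
  (2 <= n)%N ->
  G = <<[set x; y]>>%G :> {set gT} ->
  (x ^+ (2 * n) = 1)%g ->
  (x ^+ n = y ^+ 2)%g ->
  (y * x = x^-1 * y)%g ->
  #|G| = (4 * n)%N ->
  char_poly (nc_distLap G) =
    ('X * ('X - ((4 * n - 2)%N)%:R%:P) ^+ n * ('X - ((4 * n)%N)%:R%:P) ^+ n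
        * ('X - ((6 * n - 4)%N)%:R%:P) ^+ (2 * n - 3))%R.
Proof. exact: char_poly_quaternion. Qed.
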